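(* Every compact pospace is the quotient of an f-space: for every compact pospace $P$ there exists an ordered Gleason space $(X,\le,R)$ (whose underlying ordered space $(X,\le)$ is an f-space) such that $P$ is isomorphic, as an ordered topological space, to the quotient $X/{\equiv}$ equipped with the quotient topology and the order $\le_R$.
   Context: A compact pospace is a compact space $P$ with a partial order that is closed in $P^2$. For a Priestley space $X$, $\mathrm{Clop}^{\uparrow}(X)$ denotes the set of clopen upsets. An f-space is a Priestley space in which the closure of every open upset is an open upset. For a binary relation $R$ on $X$ and $E\subseteq X$, $R[-,E]=\{x\mid\exists y\in E: x\mathrel R y\}$; $(\cdot)^c$ is the complement and $\mathrm{cl}$ the closure. An ordered Gleason space is a triple $(X,\le,R)$ where $(X,\le)$ is an f-space and $R$ is a binary relation on $X$ such that: (1) $R$ is closed in $X^2$; (2) $x\le y\mathrel R z\le t$ implies $x\mathrel R t$; (3) $R$ is a pre-order; (4) $O=\mathrm{cl}(R[-,O^c]^c)$ for every $O\in\mathrm{Clop}^{\uparrow}(X)$. The equivalence relation $\equiv$ on $X$ is: $x\equiv y$ iff $x\mathrel R y$ and $y\mathrel R x$; $x^{\equiv}$ is the class of $x$, and $x^{\equiv}\le_R y^{\equiv}$ iff $x\mathrel R y$. *)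

(* Defs.v *)
From HB Require Import structures.
From mathcomp Require Import all_boot all_order all_algebra generic_quotient.
From mathcomp Require Import all_classical.
From mathcomp Require Import topology.

Set Implicit Arguments.
Unset Strict Implicit.
Unset Printing Implicit Defensive.

Import Order.TTheory.
Local Open Scope classical_set_scope.
Local Open Scope order_scope.
Local Open Scope quotient_scope.

(* [POrderedTopological] only joins a topology and a partial order on the same
   type, without any compatibility condition. *)
Notation porderTopologicalType := POrderedTopological.type.

Definition compact_pospace d (P : porderTopologicalType d) : Prop :=
  compact [set: P] /\ closed [set xy : P * P | xy.1 <= xy.2].

Definition upset d (X : porderTopologicalType d) (U : set X) : Prop :=
  forall x y, U x -> x <= y -> U y.

Definition clopen_upset d (X : porderTopologicalType d) (U : set X) : Prop :=
  clopen U /\ upset U.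

Definition priestley_space d (X : porderTopologicalType d) : Prop :=
  compact [set: X] /\
  forall x y : X, ~ x <= y -> exists U, [/\ clopen_upset U, U x & ~ U y].

Definition f_space d (X : porderTopologicalType d) : Prop :=
  priestley_space X /\
  forall U : set X, open U -> upset U ->
    open (closure U) /\ upset (closure U).

(* R[-,E] *)
Definition rel_preimage (X : Type) (R : rel X) (E : set X) : set X :=
  [set x | exists2 y, E y & R x y].

Record ordered_gleason d (X : porderTopologicalType d) (R : rel X) : Prop := {
  gleason_f_space : f_space X;
  gleason_closed : closed [set xy : X * X | R xy.1 xy.2];
  gleason_compat : forall x y z t : X, x <= y -> R y z -> z <= t -> R x t;
  gleason_refl : reflexive R;
  gleason_trans : transitive R;
  gleason_closure : forall O : set X, clopen_upset O ->
    O = closure (~` rel_preimage R (~` O))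
}.

Section gleason_quotient.
Context d (X : porderTopologicalType d) (R : rel X) (XR : ordered_gleason R).

Definition gleason_equiv : rel X := fun x y => R x y && R y x.

Lemma gleason_equiv_refl : reflexive gleason_equiv.
Proof. by move=> x; rewrite /gleason_equiv (gleason_refl XR). Qed.

Lemma gleason_equiv_sym : symmetric gleason_equiv.
Proof. by move=> x y; rewrite /gleason_equiv andbC. Qed.

Lemma gleason_equiv_trans : transitive gleason_equiv.
Proof.
move=> y x z /andP[xy yx] /andP[yz zy]; apply/andP; split.
  exact: gleason_trans XR _ _ _ xy yz.
exact: gleason_trans XR _ _ _ zy yx.
Qed.

Definition gleason_equiv_rel : equiv_rel X :=
  EquivRel gleason_equiv
    gleason_equiv_refl gleason_equiv_sym gleason_equiv_trans.

Definition gleason_quotient : topologicalType :=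
  quotient_topology {eq_quot gleason_equiv_rel}.

Definition gleason_class (x : X) : gleason_quotient :=
  \pi_({eq_quot gleason_equiv_rel}) x.

Definition gleason_quotient_le (a b : gleason_quotient) : Prop :=
  exists x y, [/\ a = gleason_class x, b = gleason_class y & R x y].

Lemma gleason_classP x y :
  gleason_class x = gleason_class y <-> R x y /\ R y x.
Proof.
split=> [/(@eqquotP _ gleason_equiv_rel) /andP//|[xy yx]].
by apply/(@eqquotP _ gleason_equiv_rel)/andP.
Qed.

Lemma gleason_quotient_leE x y :
  gleason_quotient_le (gleason_class x) (gleason_class y) <-> R x y.
Proof.
split=> [[x' [y' [/gleason_classP[xx' _] /gleason_classP[_ y'y] x'y']]]|xy].
  apply: (gleason_trans XR) y'y; exact: gleason_trans XR _ _ _ xx' x'y'.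
by exists x, y.
Qed.

End gleason_quotient.

Definition ordered_homeomorphism (T U : topologicalType)
    (leT : T -> T -> Prop) (leU : U -> U -> Prop) (f : T -> U) : Prop :=
  (exists g : U -> T,
     [/\ cancel f g, cancel g f, continuous f & continuous g]) /\
  forall x y, leT x y <-> leU (f x) (f y).

(* Main.v *)
Require Import Defs.
From HB Require Import structures.
From mathcomp Require Import all_boot all_order all_algebra generic_quotient.
From mathcomp Require Import all_classical.
From mathcomp Require Import topology.

(** Let [X] be the Priestley dual of the frame of open upsets of [P]: its points
are the prime filters of open upsets, presented as the traces of ultrafilters on
[P].  Since [P] is a compact pospace, such an ultrafilter converges, and its
limit depends only on the trace, because open upsets separate [p] from [q]
whenever [p] is not below [q].  This gives a continuous monotone surjection
[limit : X -> P], and [R x y := limit x <= limit y] makes [X] an ordered Gleason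
space whose quotient is [P].  Every open upset of [X] has a closure of the form
[{x | W \in x}], with [W] an open upset of [P], since the principal traces
[{U | p \in U}] are dense; that is also why [R] satisfies condition (4). *)

Set Implicit Arguments.
Unset Strict Implicit.
Unset Printing Implicit Defensive.

Import Order.TTheory.
Local Open Scope order_scope.
Local Open Scope classical_set_scope.

(** A set outside [F] has its complement in [F], so no proper filter finer than [F] can contain
    it. *)
Lemma ultrafilter_setVsetC T (F : set_system T) :
  ProperFilter F -> (forall A, F A \/ F (~` A)) -> UltraFilter F.
Proof.
move=> FF FVC; split=> // G GF FG; apply/seteqP; split=> // A GA.
have [//|/FG GnA] := FVC A.
by have /filter_ex[x []] : G (A `&` ~` A) by exact: filterI.
Qed.

(** * Separation in compact pospaces *)

Section compact_pospace.
Context d (P : porderTopologicalType d).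
Hypothesis cP : compact_pospace P.

Lemma compact_pospace_closed_upper (p : P) : closed [set q | p <= q].
Proof.
have /continuous_closedP : continuous (pair p : P -> P * P).
  by move=> q; apply: cvg_pair => //; exact: cvg_cst.
by move=> /(_ _ cP.2).
Qed.

(** If all neighbourhoods of [p] and [q] meet, common points [r] give diagonal pairs [(r, r)]
    arbitrarily near [(p, q)], so [p <= q] by closedness of the order. The roles are symmetric, and
    antisymmetry concludes. *)
Lemma compact_pospace_hausdorff : hausdorff_space P.
Proof.
have le_cluster (p q : P) : cluster (nbhs p) q -> p <= q.
  move=> pq; suff /cP.2 : closure [set xy : P * P | xy.1 <= xy.2] (p, q) by [].
  move=> N [[A B] /= [Ap Bq] AB].
  have [r [Ar Br]] := pq _ _ Ap Bq.
  by exists (r, r); split => //=; exact: AB.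
move=> p q pq; apply/le_anti/andP; split; apply: le_cluster => //.
by move=> A B Aq Bp; rewrite setIC; exact: pq.
Qed.

(** The down-closure of [C] is the first projection of a compact set of pairs, hence compact, hence
    closed. *)
Lemma compact_pospace_closed_down (C : set P) :
  closed C -> closed [set x | exists2 y, C y & x <= y].
Proof.
move=> Ccl; have hP := compact_pospace_hausdorff.
have Cco : compact C := subclosed_compact Ccl cP.1 (@subsetT _ C).
rewrite (_ : mkset _ =
  fst @` (([set: P] `*` C) `&` [set xy : P * P | xy.1 <= xy.2])); last first.
  apply/seteqP; split=> [x [y Cy xy]|_ [[x y] [[_ Cy] xy] <-]].
    by exists (x, y).
  by exists y.
apply: (compact_closed hP); apply: continuous_compact.
  by apply: continuous_subspaceT => x; exact: cvg_fst.
by apply: compact_closedI cP.2; exact: compact_setX cP.1 Cco.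
Qed.

Lemma open_upset_separation (p q : P) : ~ p <= q ->
  exists U : set P, [/\ open U, upset U, U p & ~ closure U q].
Proof.
move=> pq; have hP := compact_pospace_hausdorff.
have nq : nbhs q (~` [set r | p <= r]).
  apply: open_nbhs_nbhs; split=> //; apply: closed_openC.
  exact: compact_pospace_closed_upper.
have [V Vq Vp] := compact_regular hP cP.1 filterT nq.
(* By regularity [V] is a neighbourhood of [q] whose closure misses the points above [p]. Removing
   everything below that closure leaves an open upset that still contains [p] and misses [V]. *)
exists (~` [set x | exists2 y, closure V y & x <= y]); split.
- apply/closed_openC/compact_pospace_closed_down; exact: closed_closure.
- move=> x y nx xy [z Vz yz]; apply: nx; exists z => //; exact: le_trans yz.
- by move=> [y /Vp].
- move=> /(_ _ Vq)[x [nx Vx]]; apply: nx; exists x => //.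
  exact: subset_closure.
Qed.

End compact_pospace.

(** * The ordered set of traces of ultrafilters *)

Section spectrum.
Context d (P : porderTopologicalType d).

Definition ultrafilter_trace (F : set_system P) : set (set P) :=
  [set U | [/\ open U, upset U & F U]].

(** Points are traces, not ultrafilters, so that inclusion is antisymmetric. The boolean predicate
    makes [val] injective. *)
Definition spectrum : Type :=
  {x : set (set P) |
    `[< exists2 F, UltraFilter F & x = ultrafilter_trace F >]}.

HB.instance Definition _ := Choice.on spectrum.

Implicit Types (x y : spectrum) (U A B : set P).

Definition spectrum_of (F : set_system P) (FU : UltraFilter F) : spectrum :=
  exist _ (ultrafilter_trace F) (asboolT (ex_intro2 _ _ F FU erefl)).

Lemma spectrum_ultrafilter x :
  {F | UltraFilter F & val x = ultrafilter_trace F}.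
Proof. by apply: cid2; exact/asboolP/(valP x). Qed.

Definition spectrum_ext U : set spectrum := [set x | val x U].

Definition spectrum_le : rel spectrum := fun x y => `[< val x `<=` val y >].

Lemma spectrum_le_refl : reflexive spectrum_le.
Proof. by move=> x; exact/asboolP. Qed.

Lemma spectrum_le_anti : antisymmetric spectrum_le.
Proof.
by move=> x y /andP[/asboolP xy /asboolP yx]; apply/val_inj/seteqP.
Qed.

Lemma spectrum_le_trans : transitive spectrum_le.
Proof.
by move=> y x z /asboolP xy /asboolP yz; apply/asboolP/(subset_trans xy).
Qed.

HB.instance Definition _ := Order.Le_isPOrder.Build d spectrum
  spectrum_le_refl spectrum_le_anti spectrum_le_trans.

Definition open_upset U := open U /\ upset U.

Lemma spectrum_open_upset x U : val x U -> open_upset U.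
Proof. by have [F _ ->] := spectrum_ultrafilter x; case. Qed.

Lemma open_upset_setT : open_upset [set: P].
Proof. by split=> //; exact: openT. Qed.

Lemma open_upset_set0 : open_upset (@set0 P).
Proof. by split=> //; exact: open0. Qed.

Lemma open_upsetI A B : open_upset A -> open_upset B -> open_upset (A `&` B).
Proof.
move=> [oA uA] [oB uB]; split; first exact: openI.
by move=> x y [Ax Bx] xy; split; [exact: uA xy|exact: uB xy].
Qed.

Lemma open_upset_bigcup I (D : set I) (f : I -> set P) :
  (forall i, D i -> open_upset (f i)) -> open_upset (\bigcup_(i in D) f i).
Proof.
move=> fD; split; first by apply: bigcup_open => i /fD[].
by move=> x y [i Di fix_] xy; exists i => //; exact: (fD i Di).2 fix_ xy.
Qed.

Lemma open_upsetU A B : open_upset A -> open_upset B -> open_upset (A `|` B).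
Proof.
move=> [oA uA] [oB uB]; split; first exact: openU.
by move=> x y [Ax|Bx] xy; [left; exact: uA xy|right; exact: uB xy].
Qed.

Lemma spectrum_setT x : val x setT.
Proof.
have [F FU ->] := spectrum_ultrafilter x.
by have [oT uT] := open_upset_setT; split=> //; exact: filterT.
Qed.

Lemma spectrum_set0 x : ~ val x set0.
Proof.
by have [F FU ->] := spectrum_ultrafilter x; case=> _ _; exact: filter_not_empty.
Qed.

Lemma spectrumS x A B : open_upset B -> A `<=` B -> val x A -> val x B.
Proof.
have [F FU ->] := spectrum_ultrafilter x.
by move=> [oB uB] AB [_ _ FA]; split=> //; exact: filterS FA.
Qed.

Lemma spectrumI x A B : val x A -> val x B -> val x (A `&` B).
Proof.
move=> xA xB; have [oAB uAB] :=
  open_upsetI (spectrum_open_upset xA) (spectrum_open_upset xB).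
move: xA xB; have [F FU ->] := spectrum_ultrafilter x.
by move=> [_ _ FA] [_ _ FB]; split=> //; exact: filterI.
Qed.

(** Primeness of the filter [x]: this is where the trace must come from an ultrafilter and not
    merely from a proper filter. *)
Lemma spectrumU x A B : open_upset A -> open_upset B ->
  val x (A `|` B) -> val x A \/ val x B.
Proof.
have [F FU ->] := spectrum_ultrafilter x; move=> [oA uA] [oB uB] [_ _ FAB].
have [FA|FnA] := in_ultra_setVsetC A FU; first by left.
right; split=> //; apply: filterS (filterI FAB FnA).
by move=> p [[Ap|//] /(_ Ap)].
Qed.

(** * The Priestley topology on the spectrum *)

Definition spectrum_base (AB : set P * set P) : set spectrum :=
  spectrum_ext AB.1 `\` spectrum_ext AB.2.

Definition spectrum_index : set (set P * set P) :=
  [set AB | open_upset AB.1 /\ open_upset AB.2].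

Lemma spectrum_base_cover :
  \bigcup_(AB in spectrum_index) spectrum_base AB = setT.
Proof.
apply/seteqP; split=> // x _; exists (setT, set0).
  by split; [exact: open_upset_setT|exact: open_upset_set0].
by split; [exact: spectrum_setT|exact: spectrum_set0].
Qed.

Lemma spectrum_base_join AB AB' x : spectrum_index AB -> spectrum_index AB' ->
  spectrum_base AB x -> spectrum_base AB' x ->
  exists AB'', [/\ spectrum_index AB'', spectrum_base AB'' x &
    spectrum_base AB'' `<=` spectrum_base AB `&` spectrum_base AB'].
Proof.
case: AB AB' => [A B] [A' B'] [/= uA uB] [/= uA' uB'] [xA xB] [xA' xB'].
exists (A `&` A', B `|` B'); split.
- by split; [exact: open_upsetI|exact: open_upsetU].
- by split; [exact: spectrumI|case/spectrumU].
- move=> y [yA yB]; split; split => /=.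
  + exact: spectrumS uA (@subIsetl _ _ _) yA.
  + exact/(contra_not _ yB)/spectrumS/subsetUl/open_upsetU.
  + exact: spectrumS uA' (@subIsetr _ _ _) yA.
  + exact/(contra_not _ yB)/spectrumS/subsetUr/open_upsetU.
Qed.

HB.instance Definition _ := isBaseTopological.Build spectrum
  spectrum_base_cover spectrum_base_join.

Lemma spectrum_base_open AB : spectrum_index AB -> open (spectrum_base AB).
Proof.
by move=> iAB; exists [set AB]; [move=> _ ->|rewrite bigcup_set1].
Qed.

Lemma spectrum_nbhsP x (S : set spectrum) : nbhs x S <->
  exists2 AB, spectrum_index AB /\ spectrum_base AB x & spectrum_base AB `<=` S.
Proof.
split=> [|[AB [iAB xAB] ABS]].
  rewrite nbhsE => -[_ [[D Di <-] [AB DAB xAB]] DS].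
  exists AB; first by split=> //; exact: Di.
  by apply: subset_trans DS => y yAB; exists AB.
rewrite nbhsE; exists (spectrum_base AB) => //.
by split=> //; exact: spectrum_base_open.
Qed.

Lemma spectrum_ext_open U : open_upset U -> open (spectrum_ext U).
Proof.
move=> uU; rewrite (_ : spectrum_ext U = spectrum_base (U, set0)).
  by apply: spectrum_base_open; split=> //; exact: open_upset_set0.
apply/seteqP; split=> [x xU|x []//].
by split=> //; exact: spectrum_set0.
Qed.

Lemma spectrum_ext_closed U : open_upset U -> closed (spectrum_ext U).
Proof.
move=> uU; rewrite -openC (_ : ~` _ = spectrum_base (setT, U)).
  by apply: spectrum_base_open; split=> //; exact: open_upset_setT.
apply/seteqP; split=> [x xU|x []//].
by split=> //; exact: spectrum_setT.
Qed.

Lemma spectrum_ext_clopen_upset U :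
  open_upset U -> clopen_upset (spectrum_ext U).
Proof.
move=> uU; split; last by move=> x y xU /asboolP; exact.
by split; [exact: spectrum_ext_open|exact: spectrum_ext_closed].
Qed.

(* The limit of an ultrafilter on the spectrum is the trace of the sum over it
   of representing ultrafilters on [P]. *)
Lemma spectrum_compact : compact [set: spectrum].
Proof.
rewrite compact_ultra => G GU _.
pose u x := sval (spectrum_ultrafilter x).
have uU x : UltraFilter (u x) by rewrite /u; case: spectrum_ultrafilter.
have uE x U : open_upset U -> val x U <-> u x U.
  rewrite /u; case: spectrum_ultrafilter => /= F _ -> [oU uU'].
  by split=> [[]|].
pose F : set_system P := [set A | G [set x | u x A]].
have FF : ProperFilter F.
  apply: Build_ProperFilter_ex.
    by move=> A FA; have [x] := @filter_ex _ G _ _ FA; exact: filter_ex.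
  split.
  - by rewrite /F /=; apply: filterE => x; exact: filterT.
  - by move=> A B; rewrite /F /=; apply: filterS2 => x; exact: filterI.
  - by move=> A B AB; rewrite /F /=; apply: filterS => x; exact: filterS.
have FU : UltraFilter F.
  apply: ultrafilter_setVsetC => A.
  have [|GC] := in_ultra_setVsetC [set x | u x A] GU; first by left.
  right; apply: filterS GC => x /= nA.
  by have [/nA|] := in_ultra_setVsetC A (uU x).
exists (spectrum_of FU); split=> // S /spectrum_nbhsP.
move=> [[A B] [[/= uA uB] [[_ _ FA] nB]] ABS].
have {}nB : F (~` B).
  by have [FB|//] := in_ultra_setVsetC B FU; case: nB; case: uB.
move: FA nB; rewrite /F /=; apply: filterS2 => x xA xB; apply: ABS.
split; first exact/uE.
by move=> /(uE _ _ uB) uxB; have [p []] := filter_ex (filterI uxB xB).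
Qed.

Lemma spectrum_priestley : priestley_space spectrum.
Proof.
split; first exact: spectrum_compact.
move=> x y nxy; have /existsNP[U /not_implyP[xU yU]] :
  ~ forall U, val x U -> val y U by apply: contra_not nxy => xy; exact/asboolP.
exists (spectrum_ext U); split=> //.
exact/spectrum_ext_clopen_upset/spectrum_open_upset/xU.
Qed.

(** * Principal traces and closures of open upsets *)

Definition principal_spectrum (p : P) : spectrum :=
  spectrum_of (principal_filter_ultra p).

Lemma principal_spectrumE p U :
  open_upset U -> val (principal_spectrum p) U <-> U p.
Proof.
move=> [oU uU]; split=> [[_ _ /principal_filterP]//|Up].
by split=> //; exact/principal_filterP.
Qed.

(** Otherwise the sets [spectrum_ext U] minus [O], for [U] in [x], generate a proper filter on the
    compact complement of [O]. A cluster point [y] lies in each closed set [spectrum_ext U], so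
    [x <= y], and the upset [O] contains [y]: a contradiction. *)
Lemma open_upset_spectrum_ext (O : set spectrum) x : open O -> upset O -> O x ->
  exists U, [/\ open_upset U, val x U & spectrum_ext U `<=` O].
Proof.
move=> oO uO Ox; apply: contrapT => nU.
have Fx U : val x U -> spectrum_ext U `&` ~` O !=set0.
  move=> xU; apply/set0P/eqP => /disjoints_subset; rewrite setCK => UO.
  by apply: nU; exists U; split=> //; exact: spectrum_open_upset xU.
pose F := filter_from (val x) (fun U => spectrum_ext U `&` ~` O).
have FF : ProperFilter F.
  apply: filter_from_proper => //; apply: filter_from_filter.
    by exists setT; exact: spectrum_setT.
  move=> A B xA xB; exists (A `&` B); first exact: spectrumI.
  move=> y [yAB nOy]; split; split=> //.
    exact: spectrumS (spectrum_open_upset xA) (@subIsetl _ _ _) yAB.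
  exact: spectrumS (spectrum_open_upset xB) (@subIsetr _ _ _) yAB.
have Oco : compact (~` O).
  by apply: subclosed_compact spectrum_compact _; first exact: open_closedC.
have FO : F (~` O) by exists setT; [exact: spectrum_setT|move=> y []].
have [y [nOy Fy]] := Oco F FF FO.
apply: nOy; apply: uO Ox _; apply/asboolP => U xU.
apply: spectrum_ext_closed; first exact: spectrum_open_upset xU.
move=> S yS; have FU : F (spectrum_ext U) by exists U => // z [].
exact: Fy.
Qed.

Lemma principal_spectrum_dense A B x : open_upset A -> open_upset B ->
  val x A -> ~ val x B ->
  exists p, [/\ A p, ~ B p & spectrum_base (A, B) (principal_spectrum p)].
Proof.
move=> uA uB xA xB; have [p [Ap nBp]] : A `\` B !=set0.
  apply/set0P/eqP; rewrite setD_eq0 => AB; apply: xB; exact: spectrumS AB xA.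
exists p; split=> //; split; first exact/principal_spectrumE.
by move=> /(principal_spectrumE p uB).
Qed.

(** Density of the principal traces reduces lower bounds on closures to points of [P]. This serves
    both the f-space property and condition (4). *)
Lemma spectrum_ext_sub_closure W (S : set spectrum) : open_upset W ->
  (forall p, W p -> S (principal_spectrum p)) -> spectrum_ext W `<=` closure S.
Proof.
move=> uW WS x xW N /spectrum_nbhsP[[A B] [[/= uA uB] [/= xA xB]] ABN].
have [p [[Wp Ap] nBp _]] :=
  principal_spectrum_dense (open_upsetI uW uA) uB (spectrumI xW xA) xB.
exists (principal_spectrum p); split; first exact: WS.
apply: ABN; split; first exact/principal_spectrumE.
by move=> /(principal_spectrumE p uB).
Qed.

Lemma closure_open_upset_spectrum (O : set spectrum) : open O -> upset O ->
  exists2 W, open_upset W & closure O = spectrum_ext W.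
Proof.
move=> oO uO.
(* [spectrum_ext] need not commute with the infinite union [W] of [D], but every principal trace in
   [spectrum_ext W] does lie in [O], and these are dense there. *)
pose D := [set U | open_upset U /\ spectrum_ext U `<=` O].
have uW : open_upset (\bigcup_(U in D) U).
  by apply: open_upset_bigcup => U [].
exists (\bigcup_(U in D) U) => //; apply/seteqP; split.
  rewrite [X in _ `<=` X](closure_id _).1; last exact: spectrum_ext_closed.
  apply: closureS => x Ox.
  have [U [uU xU UO]] := open_upset_spectrum_ext oO uO Ox.
  by apply: spectrumS xU => //; move=> p Up; exists U.
apply: spectrum_ext_sub_closure => // p [U [uU UO] Up].
exact/UO/principal_spectrumE.
Qed.

Lemma spectrum_f_space : f_space spectrum.
Proof.
split=> [|O oO uO]; first exact: spectrum_priestley.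
have [W uW ->] := closure_open_upset_spectrum oO uO.
by have [[? _] ?] := spectrum_ext_clopen_upset uW.
Qed.

(** * The limit map onto the pospace *)

Section limit.
Hypothesis cP : compact_pospace P.

(** Both clauses mention only the trace, not the ultrafilter chosen for it. By
    [open_upset_separation] they determine [p], and they are all that is used about limits below. *)
Lemma spectrum_limit x : {p : P |
  (forall U, open_upset U -> U p -> val x U) /\
  (forall U, val x U -> closure U p)}.
Proof.
apply: cid; have [F FU ->] := spectrum_ultrafilter x.
have := cP.1; rewrite compact_ultra => /(_ F FU filterT)[p [_ Fp]].
exists p; split=> U.
  by move=> [oU uU] Up; split=> //; apply: Fp; exact: open_nbhs_nbhs.
by move=> [_ _ FUU] V /Fp FV; exact: filter_ex (filterI FUU FV).
Qed.

Definition limit x : P := sval (spectrum_limit x).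

Lemma limit_open_upset x U : open_upset U -> U (limit x) -> val x U.
Proof. by rewrite /limit; case: spectrum_limit => p /= [+ _]; exact. Qed.

Lemma limit_closure x U : val x U -> closure U (limit x).
Proof. by rewrite /limit; case: spectrum_limit => p /= [_]; exact. Qed.

(** An open upset [U] around [limit x] belongs to [x], hence to [y], so [limit y] is in its closure;
    a separating [U] would forbid this. *)
Lemma limit_homo x y : x <= y -> limit x <= limit y.
Proof.
move=> /asboolP xy; apply: contrapT => /(open_upset_separation cP)[U [oU uU Ux]].
by apply; apply/limit_closure/xy/limit_open_upset.
Qed.

Lemma principal_spectrumK : cancel principal_spectrum limit.
Proof.
move=> p; apply/le_anti/andP; split; apply: contrapT.
  move=> /(open_upset_separation cP)[U [oU uU Ul]]; apply.
  by apply/subset_closure/principal_spectrumE => //; exact: limit_open_upset Ul.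
move=> /(open_upset_separation cP)[U [oU uU Up]]; apply.
exact/limit_closure/principal_spectrumE.
Qed.

Lemma limit_continuous : continuous limit.
Proof.
apply/continuousP => W oW; rewrite openE => x Wx; apply: contrapT => nWx.
(* If continuity fails at [x], the limits outside [W] of points near [x] cluster at some [q] outside
   [W], by compactness. Separation in both directions then forces [q = limit x], which lies in
   [W]. *)
pose F : set_system P := limit @ within (~` (limit @^-1` W)) (nbhs x).
have clx : closure (~` (limit @^-1` W)) x by rewrite closure_setC.
have FF : ProperFilter F.
  by apply: fmap_proper_filter; exact: within_nbhs_proper.
have Wco : compact (~` W).
  by apply: subclosed_compact cP.1 _ => //; exact: open_closedC.
have FW : F (~` W) by exact: withinT.
have [q [nWq Fq]] := Wco F FF FW.
have Fext N : nbhs x N -> F (limit @` (N `&` limit @^-1` (~` W))).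
  by move=> xN; apply: filterS xN => y Ny nWy; exists y.
apply: nWq; suff -> : q = limit x by [].
apply/le_anti/andP; split; apply: contrapT.
  move=> /(open_upset_separation cP)[U [oU uU Uq]]; apply.
  apply: limit_closure; apply: contrapT => nxU.
  have [_ [[y [nyU _] <-] Uy]] : limit @` (~` spectrum_ext U `&`
      limit @^-1` (~` W)) `&` U !=set0.
    apply: Fq; last exact: open_nbhs_nbhs.
    apply/Fext/open_nbhs_nbhs; split=> //.
    by apply: closed_openC; exact: spectrum_ext_closed.
  by apply: nyU; exact: limit_open_upset.
move=> /(open_upset_separation cP)[U [oU uU Ux]]; apply=> N qN.
(* The interior is used because [limit y] in it makes [N] a neighbourhood of [limit y], which is in
   the closure of [U]; so [N] meets [U]. *)
have [_ [[y [yU _] <-] Ny]] : limit @` (spectrum_ext U `&`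
    limit @^-1` (~` W)) `&` N° !=set0.
  apply: Fq; last exact: nbhs_interior.
  apply/Fext/open_nbhs_nbhs; split; first exact: spectrum_ext_open.
  exact: limit_open_upset.
exact: limit_closure yU _ Ny.
Qed.

Definition limit_le : rel spectrum := fun x y => limit x <= limit y.

Lemma limit_le_gleason : ordered_gleason limit_le.
Proof.
split.
- exact: spectrum_f_space.
- have /continuous_closedP : continuous
      (fun xy : spectrum * spectrum => (limit xy.1, limit xy.2)).
    move=> [x y]; apply: cvg_pair.
      apply: (cvg_comp fst limit); last exact: limit_continuous.
      exact: cvg_fst.
    apply: (cvg_comp snd limit); last exact: limit_continuous.
    exact: cvg_snd.
  by move=> /(_ _ cP.2).
- move=> x y z t /limit_homo xy yz /limit_homo zt.
  exact: le_trans xy (le_trans yz zt).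
- by move=> x; exact: lexx.
- by move=> y x z; exact: le_trans.
(* Condition (4): being closed, [O] is [spectrum_ext W]. If [p] is in [W] and [p <= limit y], then
   [limit y] is in [W], so [y] is in [O]; density gives one inclusion. Reflexivity of [limit_le]
   gives the other. *)
move=> O [[oO cO] uO]; have [W uW] := closure_open_upset_spectrum oO uO.
rewrite -(closure_id _).1// => ->; apply/seteqP; split.
  apply: spectrum_ext_sub_closure => // p Wp [y nyW].
  rewrite /limit_le principal_spectrumK => py; apply: nyW.
  by apply: limit_open_upset => //; exact: uW.2 Wp py.
rewrite [X in _ `<=` X](closure_id _).1; last exact: spectrum_ext_closed.
apply: closureS => x nx; apply: contrapT => nxW; apply: nx.
by exists x => //; exact: lexx.
Qed.

(** * The quotient of the spectrum *)

Let X := limit_le_gleason.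

Lemma gleason_class_limit x y :
  gleason_class X x = gleason_class X y <-> limit x = limit y.
Proof.
split=> [/gleason_classP[xy yx]|xy]; first exact/le_anti/andP.
by apply/gleason_classP; rewrite /limit_le xy.
Qed.

Definition quotient_spectrum (p : P) : gleason_quotient X :=
  gleason_class X (principal_spectrum p).

Definition quotient_limit (a : gleason_quotient X) : P := limit (repr a).

Lemma gleason_class_repr (a : gleason_quotient X) : gleason_class X (repr a) = a.
Proof. exact: reprK. Qed.

Lemma quotient_limit_class x : quotient_limit (gleason_class X x) = limit x.
Proof. exact/gleason_class_limit/gleason_class_repr. Qed.

Lemma quotient_spectrumK : cancel quotient_spectrum quotient_limit.
Proof. by move=> p; rewrite quotient_limit_class principal_spectrumK. Qed.

Lemma quotient_limitK : cancel quotient_limit quotient_spectrum.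
Proof.
move=> a; rewrite -[RHS]gleason_class_repr; apply/gleason_class_limit.
exact: principal_spectrumK.
Qed.

Lemma quotient_limit_continuous : continuous quotient_limit.
Proof.
apply/quotient_continuous => x.
rewrite (_ : _ \o _ = limit); first exact: limit_continuous.
by apply/funext => y; exact: quotient_limit_class.
Qed.

(** A continuous map from a compact space to a Hausdorff one is closed: the preimage of a closed set
    of classes is the image under [limit] of a closed, hence compact, subset of the spectrum. *)
Lemma quotient_spectrum_continuous : continuous quotient_spectrum.
Proof.
apply/continuousP => O oO; rewrite -closedC.
rewrite (_ : ~` _ = limit @` (gleason_class X @^-1` (~` O))).
  apply: compact_closed (compact_pospace_hausdorff cP) _.
  apply: continuous_compact; first exact/continuous_subspaceT/limit_continuous.
  apply: subclosed_compact spectrum_compact _ => //.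
  exact: (@open_closedC _ (gleason_class X @^-1` O)).
apply/seteqP; split=> [p nOp|_ [x nOx <-]].
  by exists (principal_spectrum p) => //; exact: principal_spectrumK.
rewrite /= /quotient_spectrum (_ : gleason_class X _ = gleason_class X x)//.
by apply/gleason_class_limit; exact: principal_spectrumK.
Qed.

Lemma quotient_spectrum_ordered_homeomorphism :
  ordered_homeomorphism (fun p q : P => p <= q)
    (@gleason_quotient_le _ _ _ X) quotient_spectrum.
Proof.
split.
  exists quotient_limit; split; [exact: quotient_spectrumK|
    exact: quotient_limitK|exact: quotient_spectrum_continuous|
    exact: quotient_limit_continuous].
move=> p q; rewrite /quotient_spectrum; apply: iff_sym.
apply: (iff_trans (gleason_quotient_leE _ _ _)).
by rewrite /limit_le !principal_spectrumK.
Qed.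

End limit.
End spectrum.

Theorem mainTheorem3 (d : Order.disp_t) (P : porderTopologicalType d) :
  compact_pospace P ->
  exists (X : porderTopologicalType d) (R : rel X) (XR : ordered_gleason R)
         (f : P -> gleason_quotient XR),
    ordered_homeomorphism (fun x y : P => (x <= y)%O)
      (@gleason_quotient_le d X R XR) f.
Proof.
move=> cP; exists (spectrum P), (limit_le cP), (limit_le_gleason cP).
by exists (quotient_spectrum cP); exact: quotient_spectrum_ordered_homeomorphism.
Qed.
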